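(* Timeline Dominating Set can be solved in $\mathcal{O}(n^{2+nk}T)$ time, where $n=|V|$.
   Context: A temporal graph $\mathcal{G}=(G_1,\dots,G_T)$ is a finite sequence of simple undirected graphs (snapshots) on a common finite vertex set $V$, $n=|V|$. A temporal vertex is a pair $(v,i)$. An activity interval is a triple $(v,a,b)$ with $v\in V$, $1\le a\le b\le T$; its length is $b-a$. A $k$-activity $\ell$-timeline is a set of activity intervals with at most $k$ intervals per vertex, each of length at most $\ell$. A vertex $v$ is active at time $i$ if some $(v,a,b)$ in the timeline has $a\le i\le b$; the timeline dominates $(v,i)$ if $v\in N_{G_i}[u]$ for some $u$ active at time $i$. Timeline Dominating Set: given $\mathcal{G}$ and integers $k\ge1,\ell\ge0$, decide whether some $k$-activity $\ell$-timeline dominates all temporal vertices. *)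

(* Defs.v *)
From mathcomp Require Import all_boot.

Set Implicit Arguments.
Unset Strict Implicit.
Unset Printing Implicit Defensive.

Record sgraph (V : finType) := SGraph {
  adj : rel V;
  adj_sym : symmetric adj;
  adj_irrefl : irreflexive adj
}.

(* Times are numbered 0, ..., T - 1 instead of 1, ..., T. *)
Definition temporal_graph (V : finType) (T : nat) := T.-tuple (sgraph V).

Section TimelineDominatingSet.
Variables (V : finType) (T : nat).

(* Candidate triples (v, a, b); a <= b is imposed by [is_interval]. *)
Definition triple : finType := (V * 'I_T * 'I_T)%type.
Definition vtx (x : triple) : V := x.1.1.
Definition start (x : triple) : 'I_T := x.1.2.
Definition stop (x : triple) : 'I_T := x.2.

Definition is_interval (x : triple) : bool := start x <= stop x.
Definition interval_length (x : triple) : nat := stop x - start x.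

Definition is_timeline (k l : nat) (S : {set triple}) : bool :=
  [&& [forall x in S, is_interval x],
      [forall v : V, #|[set x in S | vtx x == v]| <= k]
    & [forall x in S, interval_length x <= l]].

Definition active (S : {set triple}) (v : V) (i : 'I_T) : bool :=
  [exists x in S, (vtx x == v) && (start x <= i <= stop x)].

Definition closed_nbh (g : sgraph V) (u : V) : {set V} :=
  [set v | (v == u) || adj g u v].

Definition dominates (G : temporal_graph V T) (S : {set triple})
    (v : V) (i : 'I_T) : bool :=
  [exists u, active S u i && (v \in closed_nbh (tnth G i) u)].

Definition timeline_dominating_set (G : temporal_graph V T) (k l : nat) : bool :=
  [exists S : {set triple},
    is_timeline k l S && [forall v : V, forall i : 'I_T, dominates G S v i]].

End TimelineDominatingSet.

(* Random access machine under the uniform cost criterion, with addition and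
   truncated subtraction as only arithmetic. Registers are addressed by
   constants, memory cells through the contents of registers; since a program
   is finite, it uses finitely many registers. *)
Inductive instr :=
  | Const of nat & nat          (* r c    R[r] := c *)
  | Add of nat & nat & nat      (* r s t  R[r] := R[s] + R[t] *)
  | Sub of nat & nat & nat      (* r s t  R[r] := R[s] - R[t] *)
  | Get of nat & nat            (* r s    R[r] := M[R[s]] *)
  | Put of nat & nat            (* r s    M[R[r]] := R[s] *)
  | Jz of nat & nat.            (* r a    jump to a if R[r] = 0 *)

Definition program := seq instr.

Record config := Config { pc : nat; regs : nat -> nat; mem : nat -> nat }.

Definition upd (m : nat -> nat) (a x : nat) : nat -> nat :=
  fun b => if b == a then x else m b.

Definition exec (i : instr) (c : config) : config :=
  let: Config q R M := c in
  match i with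
  | Const r x => Config q.+1 (upd R r x) M
  | Add r s t => Config q.+1 (upd R r (R s + R t)) M
  | Sub r s t => Config q.+1 (upd R r (R s - R t)) M
  | Get r s => Config q.+1 (upd R r (M (R s))) M
  | Put r s => Config q.+1 R (upd M (R r) (R s))
  | Jz r a => Config (if R r == 0 then a else q.+1) R M
  end.

(* The machine halts when the program counter leaves the program. *)
Definition step (p : program) (c : config) : option config :=
  omap (exec^~ c) (onth p (pc c)).

Fixpoint run (p : program) (t : nat) (c : config) : option config :=
  if t is t'.+1 then obind (run p t') (step p c) else Some c.

(* The input occupies the first memory cells; everything else is 0. *)
Definition init (x : seq nat) : config :=
  Config 0 (fun=> 0) (fun a => nth 0 x a).

(* On input x, p halts after exactly t steps with y in register 0. *)
Definition computes_in (p : program) (x : seq nat) (t y : nat) : Prop :=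
  exists c : config,
    [/\ run p t (init x) = Some c, step p c = None & regs c 0 = y].

Definition adj_bits (V : finType) (g : sgraph V) : seq nat :=
  [seq nat_of_bool (adj g u v) | u <- enum V, v <- enum V].

(* Parameters, then the row-major adjacency matrices of the snapshots. *)
Definition encode (V : finType) (T : nat) (G : temporal_graph V T)
    (k l : nat) : seq nat :=
  [:: #|V|; T; k; l] ++ flatten [seq adj_bits g | g <- G].

(* Main.v *)
Require Import Defs.
From mathcomp Require Import all_boot zify.

Set Implicit Arguments.
Unset Strict Implicit.
Unset Printing Implicit Defensive.

(** All intervals of a timeline may be taken of length exactly [l], so a timeline
is a list of pairs (vertex, start), which we sort by start. Only the word of
vertices of this list has to be guessed: given the word, start its intervals as
late as possible, that is, at time [i] start the next interval of the word only
while the active vertices do not dominate snapshot [i]. Compared with any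
solution having this word, every interval starts no earlier, hence is active at
all later times at which the solution's interval is. There are [n^(nk)] words of
length [nk], enumerated by counting in base [n]. Since [k >= T] makes the instance
trivially positive, one may assume [k < T]; then simulating one word costs
[O(n^2 T)]: every time step recomputes the dominated vertices in [O(n^2)], and each
of the [nk <= nT] letters costs [O(n)] to mark the neighbourhood of its vertex. *)

(** * A structured language on top of the machine *)

Local Notation rZero := 1 (only parsing).
Local Notation rOne := 2 (only parsing).
Local Notation store := (nat -> nat) (only parsing).

Inductive cmd :=
  | Blk of seq instr
  | Seq of cmd & cmd
  | Ite of nat & cmd & cmd
  | While of nat & cmd.

Infix ";;" := Seq (at level 60, right associativity).

Fixpoint exec_block (b : seq instr) (R M : store) : store * store :=
  if b is i :: b' then
    let c := exec i (Config 0 R M) in exec_block b' (regs c) (Defs.mem c)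
  else (R, M).

(* The time [t] is that of the compiled code, jumps included. *)
Inductive bigstep : cmd -> store -> store -> nat -> store -> store -> Prop :=
  | BigBlk b R M :
      bigstep (Blk b) R M (size b) (exec_block b R M).1 (exec_block b R M).2
  | BigSeq c1 c2 R M t1 R1 M1 t2 R2 M2 :
      bigstep c1 R M t1 R1 M1 -> bigstep c2 R1 M1 t2 R2 M2 ->
      bigstep (c1 ;; c2) R M (t1 + t2) R2 M2
  | BigIteT r c1 c2 R M t R1 M1 : R r <> 0 ->
      bigstep c1 R M t R1 M1 -> bigstep (Ite r c1 c2) R M t.+2 R1 M1
  | BigIteF r c1 c2 R M t R1 M1 : R r = 0 ->
      bigstep c2 R M t R1 M1 -> bigstep (Ite r c1 c2) R M t.+1 R1 M1
  | BigWhileT r c R M t1 R1 M1 t2 R2 M2 : R r <> 0 ->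
      bigstep c R M t1 R1 M1 -> bigstep (While r c) R1 M1 t2 R2 M2 ->
      bigstep (While r c) R M (t1 + t2).+2 R2 M2
  | BigWhileF r c R M : R r = 0 -> bigstep (While r c) R M 1 R M.

Definition target (i : instr) : option nat :=
  match i with
  | Const r _ | Add r _ _ | Defs.Sub r _ _ | Get r _ => Some r
  | Put _ _ | Jz _ _ => None
  end.

Fixpoint writes (c : cmd) : seq nat :=
  match c with
  | Blk b => pmap target b
  | c1 ;; c2 | Ite _ c1 c2 => writes c1 ++ writes c2
  | While _ c => writes c
  end.

Definition agree_off (s : seq nat) (R R' : store) : Prop :=
  forall r, r \notin s -> R' r = R r.

Lemma agree_off_trans s R1 R2 R3 :
  agree_off s R1 R2 -> agree_off s R2 R3 -> agree_off s R1 R3.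
Proof. by move=> frame12 frame23 r rs; rewrite frame23 ?frame12. Qed.

Lemma agree_off_sub s s' R R' :
  {subset s <= s'} -> agree_off s R R' -> agree_off s' R R'.
Proof. by move=> ss frame r rs; apply: frame; apply: contra rs; apply: ss. Qed.

Lemma agree_off_upd s r v R : r \in s -> agree_off s R (upd R r v).
Proof. by move=> rs q qs; rewrite /upd; case: eqP qs => // ->; rewrite rs. Qed.

Lemma exec_block_agree b R M : agree_off (writes (Blk b)) R (exec_block b R M).1.
Proof.
elim: b R M => //= i b IH R M.
apply: (@agree_off_trans _ _ (regs (exec i (Config 0 R M)))).
  by case: i => [x y|x y w|x y w|x y|x y|x y] //=; apply: agree_off_upd; rewrite mem_head.
by apply: agree_off_sub (IH _ _) => r; case: (target i) => //= q rb; rewrite inE rb orbT.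
Qed.

Lemma bigstep_agree c R M t R' M' :
  bigstep c R M t R' M' -> agree_off (writes c) R R'.
Proof.
elim=> {c R M t R' M'} /=.
- exact: exec_block_agree.
- move=> c1 c2 R M t1 R1 M1 t2 R2 M2 _ frame1 _ frame2.
  by apply: agree_off_trans (agree_off_sub _ frame1) (agree_off_sub _ frame2) => r;
    rewrite mem_cat => ->; rewrite ?orbT.
- by move=> r c1 c2 R M t R1 M1 _ _; apply: agree_off_sub => q; rewrite mem_cat => ->.
- by move=> r c1 c2 R M t R1 M1 _ _; apply: agree_off_sub => q; rewrite mem_cat orbC => ->.
- by move=> r c R M t1 R1 M1 t2 R2 M2 _ _ frame1 _; apply: agree_off_trans.
- by [].
Qed.

Fixpoint code_size (c : cmd) : nat :=
  match c with
  | Blk b => size b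
  | c1 ;; c2 => code_size c1 + code_size c2
  | Ite _ c1 c2 => (code_size c1 + code_size c2).+2
  | While _ c => (code_size c).+2
  end.

(* [Jz rZero a] is an unconditional jump, since register [rZero] always holds 0. *)
Fixpoint compile (a : nat) (c : cmd) : program :=
  match c with
  | Blk b => b
  | c1 ;; c2 => compile a c1 ++ compile (a + code_size c1) c2
  | Ite r c1 c2 =>
      Jz r (a + code_size c1).+2 :: compile a.+1 c1 ++
      Jz rZero (a + (code_size c1 + code_size c2).+2) :: compile (a + code_size c1).+2 c2
  | While r c =>
      Jz r (a + (code_size c).+2) :: compile a.+1 c ++ [:: Jz rZero a]
  end.

Definition is_jump (i : instr) : bool := if i is Jz _ _ then true else false.

Fixpoint jump_free (c : cmd) : bool :=
  match c with
  | Blk b => ~~ has is_jump b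
  | c1 ;; c2 | Ite _ c1 c2 => jump_free c1 && jump_free c2
  | While _ c => jump_free c
  end.

Lemma size_compile a c : size (compile a c) = code_size c.
Proof.
elim: c a => [b|c1 IH1 c2 IH2|r c1 IH1 c2 IH2|r c IH] a //=;
  rewrite !size_cat /= ?IH1 ?IH2 ?IH; lia.
Qed.

Definition code_at (p : program) (a : nat) (s : program) : Prop :=
  forall j i, onth s j = Some i -> onth p (a + j) = Some i.

Lemma code_at_cat p a s1 s2 : code_at p a (s1 ++ s2) ->
  code_at p a s1 /\ code_at p (a + size s1) s2.
Proof.
move=> at12; split=> j i s_j.
  apply: at12; rewrite onth_cat; case: ltnP => // s1_j.
  by move: s_j; rewrite onth_default.
by rewrite -addnA; apply: at12; rewrite onth_cat ltnNge leq_addr addKn.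
Qed.

Lemma code_at_cons p a i s : code_at p a (i :: s) ->
  onth p a = Some i /\ code_at p a.+1 s.
Proof.
move=> at_is; split; first by rewrite -[a]addn0; apply: at_is.
by move=> j x s_j; rewrite addSnnS; apply: at_is.
Qed.

Lemma run_add p t1 t2 c : run p (t1 + t2) c = obind (run p t2) (run p t1 c).
Proof. by elim: t1 c => [|t1 IH] c //=; case: (step p c) => //=. Qed.

Lemma run_at p a i t R M : onth p a = Some i ->
  run p t.+1 (Config a R M) = run p t (exec i (Config a R M)).
Proof. by move=> at_i /=; rewrite /step /= at_i. Qed.

Arguments run : simpl never.

Lemma run_block p a b R M : ~~ has is_jump b -> code_at p a b ->
  run p (size b) (Config a R M) =
    Some (Config (a + size b) (exec_block b R M).1 (exec_block b R M).2).
Proof.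
elim: b a R M => [|i b IH] a R M /=; first by rewrite addn0.
rewrite negb_or => /andP[i_straight b_straight] /code_at_cons[at_i at_b].
rewrite -addSnnS.
by case: i i_straight at_i => [x y|x y w|x y w|x y|x y|x y] // _ at_i;
   rewrite (run_at _ _ _ at_i) /= IH.
Qed.

Lemma run_compile c R M t R' M' : bigstep c R M t R' M' ->
  jump_free c -> rZero \notin writes c -> R rZero = 0 ->
  forall p a, code_at p a (compile a c) ->
  run p t (Config a R M) = Some (Config (a + code_size c) R' M').
Proof.
elim=> {c R M t R' M'}.
- by move=> b R M /= b_straight _ _ p a; apply: run_block.
- move=> c1 c2 R M t1 R1 M1 t2 R2 M2 steps1 IH1 steps2 IH2 /= /andP[straight1 straight2].
  rewrite mem_cat negb_or => /andP[keep1 keep2] R_zero p a /code_at_cat[at1 at2].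
  rewrite size_compile in at2.
  rewrite run_add IH1 //= IH2 //; first by rewrite addnA.
  by rewrite (bigstep_agree steps1).
- move=> r c1 c2 R M t R1 M1 /eqP/negbTE Rr steps1 IH1 /= /andP[straight1 straight2].
  rewrite mem_cat negb_or => /andP[keep1 keep2] R_zero p a.
  move=> /code_at_cons[at_test /code_at_cat[at1 /code_at_cons[at_jump _]]].
  rewrite size_compile in at_jump; rewrite (run_at _ _ _ at_test) /= Rr.
  rewrite -[t.+1]addn1 run_add IH1 // [obind _ _]/= -addSn (run_at _ _ _ at_jump) /=.
  by rewrite (bigstep_agree steps1) // R_zero eqxx.
- move=> r c1 c2 R M t R1 M1 Rr steps2 IH2 /= /andP[straight1 straight2].
  rewrite mem_cat negb_or => /andP[keep1 keep2] R_zero p a.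
  move=> /code_at_cons[at_test /code_at_cat[at1 /code_at_cons[_ at2]]].
  rewrite size_compile addSn in at2.
  rewrite (run_at _ _ _ at_test) /= Rr eqxx IH2 //.
  by congr (Some (Config _ _ _)); lia.
- move=> r c R M t1 R1 M1 t2 R2 M2 /eqP/negbTE Rr steps1 IH1 steps2 IH2 /=.
  move=> c_straight c_keep R_zero p a at_loop.
  have [at_test /code_at_cat[at_body /code_at_cons[at_jump _]]] := code_at_cons at_loop.
  rewrite size_compile in at_jump; rewrite (run_at _ _ _ at_test) /= Rr.
  have R1_zero : R1 rZero = 0 by rewrite (bigstep_agree steps1).
  rewrite -addnS run_add IH1 // [obind _ _]/= (run_at _ _ _ at_jump) /= R1_zero eqxx.
  exact: IH2.
- move=> r c R M Rr /= c_straight c_keep R_zero p a /code_at_cons[at_test _].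
  by rewrite (run_at _ _ _ at_test) /= Rr eqxx.
Qed.

Lemma compile_computes c x t R' M' :
  bigstep c (fun=> 0) (nth 0 x) t R' M' ->
  jump_free c -> rZero \notin writes c -> computes_in (compile 0 c) x t (R' 0).
Proof.
move=> steps c_straight c_keep; exists (Config (code_size c) R' M'); split=> //.
  exact: (run_compile steps c_straight c_keep).
by rewrite /step onth_default // size_compile.
Qed.

Definition runs (c : cmd) (R M : store) (t : nat) (P : store -> store -> Prop) : Prop :=
  exists t' R' M', [/\ bigstep c R M t' R' M', t' <= t & P R' M'].

Lemma runs_conseq c R M t1 t (P Q : store -> store -> Prop) :
  runs c R M t1 P -> t1 <= t ->
  (forall R' M', agree_off (writes c) R R' -> P R' M' -> Q R' M') ->
  runs c R M t Q.
Proof.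
move=> [t' [R' [M' [steps t't PR']]]] t1t PQ; exists t', R', M'; split=> //.
  exact: leq_trans t't t1t.
by apply: PQ PR'; apply: bigstep_agree steps.
Qed.

Lemma runs_blk b R M t (P : store -> store -> Prop) :
  size b <= t -> P (exec_block b R M).1 (exec_block b R M).2 -> runs (Blk b) R M t P.
Proof. by move=> bt Pb; exists (size b); do 2 eexists; split; first exact: BigBlk. Qed.

Lemma runs_seq c1 c2 R M t1 t (P Q : store -> store -> Prop) :
  runs c1 R M t1 P -> t1 <= t ->
  (forall R' M', agree_off (writes c1) R R' -> P R' M' -> runs c2 R' M' (t - t1) Q) ->
  runs (c1 ;; c2) R M t Q.
Proof.
move=> [t1' [R1 [M1 [steps1 t1'_le PR1]]]] t1t PQ.
have [t2' [R2 [M2 [steps2 t2'_le QR2]]]] := PQ _ _ (bigstep_agree steps1) PR1.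
by exists (t1' + t2'), R2, M2; split=> //; [apply: BigSeq steps1 steps2|lia].
Qed.

Lemma runs_blk_seq b c R M t P : size b <= t ->
  runs c (exec_block b R M).1 (exec_block b R M).2 (t - size b) P ->
  runs (Blk b ;; c) R M t P.
Proof.
move=> bt run_c; apply: (@runs_seq _ _ _ _ (size b) _
  (fun R' M' => exec_block b R M = (R', M'))) => //.
  by apply: runs_blk => //; case: exec_block.
by move=> R' M' _ exec_b; rewrite exec_b in run_c.
Qed.

Lemma runs_ite r c1 c2 R M t P : 2 <= t ->
  (R r <> 0 -> runs c1 R M (t - 2) P) -> (R r = 0 -> runs c2 R M (t - 1) P) ->
  runs (Ite r c1 c2) R M t P.
Proof.
move=> t2 run_then run_else.
case: (R r =P 0) => [/[dup] Rr /run_else|/[dup] Rr /run_then] [t' [R' [M' [steps t't PR']]]].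
  by exists t'.+1, R', M'; split=> //; [exact: BigIteF|lia].
by exists t'.+2, R', M'; split=> //; [exact: BigIteT|lia].
Qed.

Lemma runs_while r c R M t P : 2 <= t ->
  (R r <> 0 -> runs (c ;; While r c) R M (t - 2) P) -> (R r = 0 -> P R M) ->
  runs (While r c) R M t P.
Proof.
move=> t2 run_body P_exit; case: (R r =P 0) => [/[dup] Rr /P_exit|/[dup] Rr /run_body].
  by move=> PR; exists 1, R, M; split=> //; [exact: BigWhileF|lia].
move=> [t' [R' [M' [steps t't PR']]]].
inversion steps as [|? ? ? ? t1 R1 M1 t2' ? ? steps1 steps2| | | |]; subst.
by exists (t1 + t2').+2, R', M'; split=> //; [exact: BigWhileT steps1 steps2|lia].
Qed.

Lemma updE m a x b : upd m a x b = if b == a then x else m b.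
Proof. by []. Qed.

(* [h] holds the number of iterations still to be done. *)
Definition for_loop (i h b : nat) (c : cmd) : cmd :=
  Blk [:: Const i 0; Add h b rZero] ;;
  While h (c ;; Blk [:: Add i i rOne; Defs.Sub h b i]).

Definition valid_loop (i h b : nat) (c : cmd) : bool :=
  [&& i \notin [:: rZero, h & writes c], b \notin [:: i, h & writes c]
    & rOne \notin [:: i, h & writes c]].

Section ForLoop.
Variables (i h b : nat) (c : cmd) (t : nat -> nat) (R M : store).
Variable I : nat -> store -> store -> Prop.
Hypothesis valid : valid_loop i h b c.
Hypothesis I_stable : forall j R1 R2 M1, agree_off [:: i; h] R1 R2 -> I j R1 M1 -> I j R2 M1.
Hypotheses (R_zero : R rZero = 0) (R_one : R rOne = 1).
Hypothesis body : forall j R1 M1, j < R b -> R1 i = j ->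
  agree_off [:: i, h & writes c] R R1 -> I j R1 M1 -> runs c R1 M1 (t j) (I j.+1).

Definition loop_state (j : nat) (R1 M1 : store) : Prop :=
  [/\ R1 i = j, R1 h = R b - j, agree_off [:: i, h & writes c] R R1 & I j R1 M1].

Lemma loop_state_upd j R1 M1 : agree_off [:: i, h & writes c] R R1 -> I j R1 M1 ->
  loop_state j (upd (upd R1 i j) h (R b - j)) M1.
Proof.
move=> frame1 Ij; have /and3P[+ _ _] := valid; rewrite in_cons in_cons !negb_or.
move=> /and3P[_ /negbTE ih _].
have frame2 : agree_off [:: i; h] R1 (upd (upd R1 i j) h (R b - j)).
  by apply: (@agree_off_trans _ _ (upd R1 i j)); apply: agree_off_upd; rewrite !inE eqxx ?orbT.
split; rewrite ?updE ?ih ?eqxx //; last exact: I_stable frame2 Ij.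
apply: agree_off_trans frame1 (agree_off_sub _ frame2) => r.
by rewrite !in_cons in_nil orbF orbA => ->.
Qed.

Lemma runs_for_iteration j R1 M1 : j < R b -> loop_state j R1 M1 ->
  runs (c ;; Blk [:: Add i i rOne; Defs.Sub h b i]) R1 M1 (t j + 2) (loop_state j.+1).
Proof.
move=> jb [R1i _ frame1 Ij]; have /and3P[ic bc onec] := valid.
apply: runs_seq (body jb R1i frame1 Ij) _ _ => [|R2 M2 frame2 Ij1]; first lia.
have frame : agree_off [:: i, h & writes c] R R2.
  by apply: agree_off_trans frame1 (agree_off_sub _ frame2) => r rc; rewrite !in_cons rc !orbT.
apply: runs_blk => /=; first by rewrite addKn.
have -> : R2 i = j by rewrite frame2 //; move: ic; rewrite !in_cons !negb_or => /and3P[].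
have -> : upd R2 i (j + R2 rOne) b = R b.
  by rewrite updE; case: eqP bc => [->|_ bc]; rewrite ?mem_head // frame.
rewrite (frame _ onec) R_one addn1 updE eqxx; exact: loop_state_upd.
Qed.

Lemma runs_for_from m j R1 M1 : j + m = R b -> loop_state j R1 M1 ->
  runs (While h (c ;; Blk [:: Add i i rOne; Defs.Sub h b i])) R1 M1
    (\sum_(j <= q < R b) (t q + 4) + 2) (I (R b)).
Proof.
elim: m j R1 M1 => [|m IH] j R1 M1 jm st; have [R1i R1h frame1 Ij] := st;
  (apply: runs_while; first exact: leq_addl); rewrite R1h -jm addKn // => _.
  by move: Ij; rewrite addn0.
have jb : j < R b by lia.
rewrite jm big_ltn //; apply: runs_seq (runs_for_iteration jb st) _ _ => [|R2 M2 _ st2].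
  lia.
by apply: runs_conseq (IH j.+1 _ _ _ st2) _ _ => //; lia.
Qed.

Lemma runs_for : I 0 R M ->
  runs (for_loop i h b c) R M (\sum_(0 <= q < R b) (t q + 4) + 4) (I (R b)).
Proof.
move=> I0; have /and3P[ic bc _] := valid.
apply: runs_blk_seq => /=; first lia.
have -> : upd R i 0 b + upd R i 0 rZero = R b - 0.
  move: ic bc; rewrite !updE !in_cons !negb_or => /andP[i0 _] /andP[/negbTE-> _].
  by rewrite eq_sym (negbTE i0) R_zero addn0 subn0.
have time_le : \sum_(0 <= q < R b) (t q + 4) + 2 <= \sum_(0 <= q < R b) (t q + 4) + 4 - 2.
  by lia.
by apply: runs_conseq (runs_for_from (add0n _) (loop_state_upd _ I0)) time_le _.
Qed.

End ForLoop.

Lemma runs_for_const i h b c I t R M :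
  valid_loop i h b c ->
  (forall j R1 R2 M1, agree_off [:: i; h] R1 R2 -> I j R1 M1 -> I j R2 M1) ->
  R rZero = 0 -> R rOne = 1 ->
  (forall j R1 M1, j < R b -> R1 i = j -> agree_off [:: i, h & writes c] R R1 ->
     I j R1 M1 -> runs c R1 M1 t (I j.+1)) ->
  I 0 R M -> runs (for_loop i h b c) R M (R b * (t + 4) + 4) (I (R b)).
Proof.
move=> valid stable R0 R1 body I0.
have := runs_for (t := fun=> t) valid stable R0 R1 body I0.
by rewrite sum_nat_const_nat subn0.
Qed.

(** * Greedy schedules *)

Lemma iota0S m : iota 0 m.+1 = rcons (iota 0 m) m.
Proof. by rewrite -addn1 iotaD cats1. Qed.

Lemma size_le_count (n k : nat) (s : seq nat) :
  all (gtn n) s -> (forall v, count_mem v s <= k) -> size s <= n * k.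
Proof.
move=> s_lt s_count; rewrite -(eqP (etrans (esym (all_count _ _)) s_lt)) {s_lt}.
elim: n => [|m IH]; first by rewrite (eq_count (a2 := pred0)) ?count_pred0.
rewrite (eq_count (a2 := predU (gtn m) (pred1 m))); last by move=> v /=; lia.
apply: leq_trans (leq_addr (count (predI (gtn m) (pred1 m)) s) _) _.
by rewrite count_predUI mulSn addnC leq_add.
Qed.

(* An item (u, a) stands for the activity interval (u, a, a + l). *)
Local Notation schedule := (seq (nat * nat)) (only parsing).

Section Greedy.
Variables (n T k l : nat) (nbr : nat -> nat -> nat -> bool).

Definition covers (s : schedule) (i v : nat) : bool :=
  has (fun x => (x.2 <= i <= x.2 + l) && nbr i x.1 v) s.

Definition dominated (i : nat) (s : schedule) : bool := all (covers s i) (iota 0 n).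

Definition feasible (s : schedule) : Prop :=
  all (gtn n) (unzip1 s) /\ forall v, count_mem v (unzip1 s) <= k.

Definition solvable : Prop :=
  exists2 s, feasible s & forall i, i < T -> dominated i s.

Lemma dominated_sub i s s' : {subset s <= s'} -> dominated i s -> dominated i s'.
Proof.
move=> ss; apply: sub_all => v /hasP[x xs xv].
by apply/hasP; exists x => //; apply: ss.
Qed.

Definition starts_by (i : nat) (s : schedule) : bool := all (fun x => x.2 <= i) s.

Definition until (s : schedule) (u : nat) : nat :=
  \max_(x <- s | x.1 == u) (x.2 + l).+1.

Definition left (s : schedule) (v : nat) : nat := k - count_mem v (unzip1 s).

Lemma ltn_until s u i :
  (i < until s u) = has (fun x => (x.1 == u) && (i <= x.2 + l)) s.
Proof.
rewrite /until; elim: s => [|x s IH]; first by rewrite big_nil.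
by rewrite big_cons /= -IH; case: eqP => //= _; rewrite leq_max ltnS.
Qed.

Lemma until_cons i v s : starts_by i s -> until ((v, i) :: s) =1 upd (until s) v (i + l).+1.
Proof.
move=> s_i u; rewrite /until big_cons /= /upd eq_sym; case: eqP => // ->.
apply/maxn_idPl/bigmax_leqP_seq => x xs _; rewrite ltnS leq_add2r.
exact: (allP s_i).
Qed.

Lemma left_cons v i s : left ((v, i) :: s) =1 upd (left s) v (left s v).-1.
Proof.
move=> u; rewrite /left /upd /= [v == u]eq_sym; case: eqP => [->|//].
by rewrite add1n subnS.
Qed.

Lemma covers_until s i v : starts_by i s -> all (gtn n) (unzip1 s) ->
  covers s i v = has (fun u => (i < until s u) && nbr i u v) (iota 0 n).
Proof.
move=> s_i s_n; apply/hasP/hasP.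
  move=> [x xs /andP[/andP[_ ix] xv]]; exists x.1.
    by rewrite mem_iota; apply: (allP s_n); apply: map_f.
  by rewrite xv ltn_until andbT; apply/hasP; exists x; rewrite ?eqxx.
move=> [u _ /andP[+ uv]]; rewrite ltn_until => /hasP[x xs /andP[/eqP xu ix]].
by exists x; rewrite // xu uv ix (allP s_i x xs).
Qed.

Definition pull_letter (i v : nat) (s : schedule) : schedule :=
  if 0 < left s v then (v, i) :: s else s.

Fixpoint pull (i : nat) (w : seq nat) (s : schedule) : seq nat * schedule :=
  if w is v :: w' then
    if dominated i s then (w, s)
    else pull i w' (pull_letter i v s)
  else (w, s).

Fixpoint greedy (w : seq nat) (i : nat) : seq nat * schedule :=
  if i is j.+1 then let: (w', s) := greedy w j in pull j w' s else (w, [::]).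

Definition succeeds (w : seq nat) (m : nat) : bool :=
  all (fun i => dominated i (greedy w i.+1).2) (iota 0 m).

Lemma greedyS w i : greedy w i.+1 = pull i (greedy w i).1 (greedy w i).2.
Proof. by rewrite /=; case: greedy. Qed.

Lemma succeedsS w m :
  succeeds w m.+1 = succeeds w m && dominated m (greedy w m.+1).2.
Proof. by rewrite /succeeds iota0S all_rcons andbC. Qed.

Lemma pull_dominated i w s : dominated i s -> pull i w s = (w, s).
Proof. by case: w => //= v w ->. Qed.

Lemma pull_size i w s : size (pull i w s).1 <= size w.
Proof.
by elim: w s => //= v w IH s; case: ifP => // _; apply: leq_trans (IH _) _.
Qed.

Lemma sum_consumed w m :
  \sum_(0 <= i < m) (size (greedy w i).1 - size (greedy w i.+1).1) + size (greedy w m).1 =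
  size w.
Proof.
elim: m => [|m IH]; first by rewrite big_nil.
by rewrite big_nat_recr // -addnA subnK // greedyS pull_size.
Qed.

Lemma pull_letter_sub i v s : {subset s <= pull_letter i v s}.
Proof. by move=> x xs; rewrite /pull_letter; case: ifP => // _; rewrite inE xs orbT. Qed.

Lemma pull_sub i w s : {subset s <= (pull i w s).2}.
Proof.
elim: w s => [s x //|v w IH s x xs] /=; case: ifP => // _.
exact/IH/pull_letter_sub.
Qed.

Lemma pull_letter_feasible i v s : v < n -> feasible s -> feasible (pull_letter i v s).
Proof.
rewrite /pull_letter; case: ifP => // v_left vn [s_n s_count]; split=> [|u] /=; first by rewrite vn.
by have := s_count u; case: eqP => // <- _; rewrite add1n -subn_gt0.
Qed.

Lemma pull_letter_starts_by i v s : starts_by i s -> starts_by i (pull_letter i v s).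
Proof. by rewrite /pull_letter; case: ifP => //= _ ->; rewrite leqnn. Qed.

Lemma pull_feasible i w s : all (gtn n) w -> feasible s -> starts_by i s ->
  [/\ all (gtn n) (pull i w s).1, feasible (pull i w s).2 & starts_by i (pull i w s).2].
Proof.
elim: w s => [|v w IH] s //= /andP[vn wn] s_ok s_i; case: ifP => _ /=; first by rewrite vn.
by apply: IH => //; [apply: pull_letter_feasible|apply: pull_letter_starts_by].
Qed.

Lemma greedy_feasible w i : all (gtn n) w ->
  [/\ all (gtn n) (greedy w i).1, feasible (greedy w i).2 & starts_by i (greedy w i).2].
Proof.
move=> wn; elim: i => [|i [wn' s_ok s_i]] //; rewrite greedyS.
have [wn2 s2_ok s2_i] := pull_feasible wn' s_ok s_i; split=> //.
by apply: sub_all s2_i => x; apply: leqW.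
Qed.

Lemma greedy_sub w i j : i <= j -> {subset (greedy w i).2 <= (greedy w j).2}.
Proof.
move=> /subnK <-; elim: (j - i) => // m IH x /IH xs.
by rewrite addSn greedyS; apply: pull_sub.
Qed.

Lemma succeeds_solvable w : all (gtn n) w -> succeeds w T -> solvable.
Proof.
move=> wn /allP w_ok; exists (greedy w T).2; first by case: (greedy_feasible T wn).
move=> i iT; apply: dominated_sub (w_ok i _); first exact: greedy_sub.
by rewrite mem_iota.
Qed.

Definition delays (i : nat) (a s : schedule) : Prop :=
  (forall v, count_mem v (unzip1 s) = count_mem v (unzip1 a)) /\
  {in a, forall x, exists2 y, y \in s & y.1 = x.1 /\ x.2 <= y.2 <= i}.

Lemma delays_covers i a s v : delays i a s -> covers a i v -> covers s i v.
Proof.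
move=> [_ as_] /hasP[x xa /andP[/andP[_ ix] xv]]; have [y ys [yx /andP[xy yi]]] := as_ x xa.
by apply/hasP; exists y; rewrite // yx xv yi andbT (leq_trans ix) // leq_add2r.
Qed.

Lemma delays_rcons i a s x :
  delays i a s -> x.2 <= i -> delays i (rcons a x) ((x.1, i) :: s).
Proof.
move=> [as_count as_] xi; split=> [v|y].
  by rewrite /= as_count /unzip1 map_rcons -cats1 count_cat /= addn0 addnC.
rewrite mem_rcons inE => /predU1P[->|/as_[z zs [zy yz]]].
  by exists (x.1, i); rewrite ?mem_head //= xi leqnn.
by exists z; rewrite // inE zs orbT.
Qed.

Lemma delays_leq i j a s : i <= j -> delays i a s -> delays j a s.
Proof.
move=> ij [as_count as_]; split=> // x /as_[y ys [yx /andP[xy yi]]].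
by exists y; rewrite // xy (leq_trans yi).
Qed.

Lemma undominated_starts i a x b s : sorted leq (unzip2 (a ++ x :: b)) ->
  dominated i (a ++ x :: b) -> delays i a s -> ~~ dominated i s -> x.2 <= i.
Proof.
move=> ab_sorted /allP ab_i as_ /allPn[v vn s_v].
have := ab_i v vn; rewrite /covers has_cat => /orP[/(delays_covers as_)|].
  by rewrite (negbTE s_v).
move=> /hasP[y y_xb /andP[/andP[yi _] _]]; apply: leq_trans yi.
move: ab_sorted; rewrite /unzip2 map_cat => /cat_sorted2[_] /=.
rewrite (path_sortedE leq_trans) => /andP[/allP x_le _].
by move: y_xb; rewrite inE => /predU1P[->//|yb]; apply/x_le/map_f.
Qed.

Lemma pull_delays i a b pad s : sorted leq (unzip2 (a ++ b)) ->
  (forall v, count_mem v (unzip1 (a ++ b)) <= k) -> dominated i (a ++ b) -> delays i a s ->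
  exists a' b', [/\ a ++ b = a' ++ b', (pull i (unzip1 b ++ pad) s).1 = unzip1 b' ++ pad,
    delays i a' (pull i (unzip1 b ++ pad) s).2 & dominated i (pull i (unzip1 b ++ pad) s).2].
Proof.
move=> + + + as_; elim: b a s as_ => [|x b IH] a s as_ ab_sorted ab_count ab_i.
  have s_i : dominated i s.
    by move: ab_i; rewrite cats0; apply: sub_all => v; apply: delays_covers.
  by exists a, [::]; rewrite pull_dominated.
have [s_i|s_i] := boolP (dominated i s).
  by exists a, (x :: b); rewrite pull_dominated.
have xi := undominated_starts ab_sorted ab_i as_ s_i.
have x_left : 0 < left s x.1.
  rewrite subn_gt0; case: as_ => -> _; apply: leq_trans (ab_count x.1).
  by rewrite /unzip1 map_cat count_cat /= eqxx addnCA leq_addr.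
rewrite /= (negbTE s_i) /pull_letter x_left -cat_rcons.
by apply: IH; rewrite ?cat_rcons //; apply: delays_rcons.
Qed.

Lemma greedy_delays s pad i : sorted leq (unzip2 s) -> feasible s ->
  (forall j, j < i -> dominated j s) ->
  exists a b, [/\ s = a ++ b, (greedy (unzip1 s ++ pad) i).1 = unzip1 b ++ pad,
    delays i a (greedy (unzip1 s ++ pad) i).2 & succeeds (unzip1 s ++ pad) i].
Proof.
set w := _ ++ pad => s_sorted [_ s_count].
elim: i => [|i IH] s_dom; first by exists [::], s.
have [j ji|a [b [s_ab w_b as_ ok]]] := IH; first by apply/s_dom/leqW.
rewrite s_ab in s_sorted s_count s_dom.
have [a' [b' [ab w_b' as_' dom]]] := pull_delays pad s_sorted s_count (s_dom i (leqnn _)) as_.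
exists a', b'; rewrite succeedsS greedyS ok w_b; split=> //; first by rewrite s_ab.
exact: delays_leq (leqnSn i) as_'.
Qed.

Lemma solvable_succeeds : 0 < n -> solvable ->
  exists w, [/\ size w = n * k, all (gtn n) w & succeeds w T].
Proof.
move=> n0 [s0 [s0_n s0_count] s0_dom]; pose s := sort (relpre snd leq) s0.
have s_s0 : perm_eq s s0 by rewrite perm_sort.
have s_n : all (gtn n) (unzip1 s) by rewrite (perm_all _ (perm_map fst s_s0)).
have s_count v : count_mem v (unzip1 s) <= k by rewrite (permP (perm_map fst s_s0)).
have s_sorted : sorted leq (unzip2 s).
  by rewrite sorted_map; apply: sort_sorted => x y; apply: leq_total.
have s_size := size_le_count s_n s_count.
pose pad : seq nat := nseq (n * k - size (unzip1 s)) 0.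
exists (unzip1 s ++ pad); split.
- by rewrite size_cat size_nseq subnKC.
- by rewrite all_cat s_n all_nseq /=; lia.
have [|i iT|a [b [_ _ _ ok]]] := @greedy_delays s pad T s_sorted; first by split.
  by apply: dominated_sub (s0_dom i iT) => x; rewrite (perm_mem s_s0).
exact: ok.
Qed.

Definition digit (N j : nat) : nat := N %/ n ^ j %% n.

Definition word (N : nat) : seq nat := mkseq (digit N) (n * k).

Lemma digits_onto w : all (gtn n) w ->
  exists2 N, N < n ^ size w & w = mkseq (digit N) (size w).
Proof.
elim: w => [|d w IH] /=; first by exists 0.
move=> /andP[dn /IH[N N_lt w_N]]; exists (N * n + d).
  by rewrite expnS; nia.
rewrite /mkseq /= (iotaDl 1 0) -map_comp {1}w_N; congr (_ :: _).
  by rewrite /digit expn0 divn1 modnMDl modn_small.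
by apply: eq_map => j; rewrite /digit /= add1n expnS divnMA divnMDl ?(divn_small dn) ?addn0; lia.
Qed.

Lemma digit_lt N j : 0 < n -> digit N j < n.
Proof. exact: ltn_pmod. Qed.

Lemma digit_carry N j : 0 < n ->
  (n <= digit N j + (n ^ j %| N.+1)) = (n ^ j.+1 %| N.+1).
Proof.
move=> n0; have [dvd|ndvd] := boolP (n ^ j %| N.+1); last first.
  rewrite addn0 leqNgt digit_lt //; apply/esym/negbTE; apply: contra ndvd.
  by apply: dvdn_trans; rewrite expnS dvdn_mull.
have := dvd; rewrite addn1 expnS -dvdn_divRL // divnS ?expn_gt0 ?n0 // dvd add1n.
have -> : (n %| (N %/ n ^ j).+1) = (n %| (digit N j).+1).
  by rewrite /dvdn -addn1 -modnDml addn1.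
move=> _; apply/idP/idP => [n_le|/dvdn_leq->//].
by rewrite (_ : (digit N j).+1 = n) //; apply/eqP; rewrite eqn_leq digit_lt.
Qed.

Lemma digitS N j : 0 < n ->
  digit N.+1 j = if n ^ j.+1 %| N.+1 then 0 else digit N j + (n ^ j %| N.+1).
Proof.
move=> n0; rewrite -digit_carry // /digit divnS ?expn_gt0 ?n0 // addnC -modnDml -/(digit N j).
have d_lt := digit_lt N j n0.
case: (leqP n (digit N j + _)) => [n_le|lt_n]; last exact: modn_small.
have -> : digit N j + (n ^ j %| N.+1) = n by case: (_ %| _) n_le => /=; lia.
exact: modnn.
Qed.

Lemma all_word N : 0 < n -> all (gtn n) (word N).
Proof. by move=> n0; apply/allP => v /mapP[j _ ->]; apply: digit_lt. Qed.

Definition found (N : nat) : bool := has (fun N' => succeeds (word N') T) (iota 0 N).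

Lemma foundS N : found N.+1 = found N || succeeds (word N) T.
Proof. by rewrite /found iota0S has_rcons orbC. Qed.

Lemma solvable_found : 0 < n -> solvable <-> found (n ^ (n * k)).
Proof.
move=> n0; split=> [/(solvable_succeeds n0)[w [w_size wn w_ok]]|].
  have [N N_lt w_N] := digits_onto wn; rewrite w_size in N_lt w_N.
  by apply/hasP; exists N; rewrite ?mem_iota // /word -w_N.
by case/hasP => N _; apply: succeeds_solvable; apply: all_word.
Qed.

End Greedy.

(** * Encoding of the instance *)

Lemma nth_flatten_const (A : Type) (x0 : A) (ss : seq (seq A)) m i j :
  all (fun s => size s == m) ss -> j < m -> i < size ss ->
  nth x0 (flatten ss) (i * m + j) = nth x0 (nth [::] ss i) j.
Proof.
elim: ss i => [|s ss IH] [|i] //= /andP[/eqP sm ssm] jm.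
  by rewrite mul0n add0n nth_cat sm jm.
rewrite ltnS => im; rewrite nth_cat sm ifF; last by apply/negbTE; nia.
by rewrite -IH //; congr nth; rewrite mulSn -addnA addKn.
Qed.

Definition input_nbr (x : seq nat) (n i u v : nat) : bool :=
  (v == u) || (nth 0 x (4 + i * (n * n) + n * u + v) != 0).

Section Encoding.
Variables (V : finType) (T : nat) (G : temporal_graph V T) (k l : nat).
Let n := #|V|.
Let nbr := input_nbr (encode G k l) n.

Lemma size_adj_bits (g : sgraph V) : size (adj_bits g) = n * n.
Proof. by rewrite /adj_bits size_allpairs -cardE. Qed.

Lemma all_size_adj_bits (gs : seq (sgraph V)) :
  all (fun bits => size bits == n * n) [seq adj_bits g | g <- gs].
Proof. by elim: gs => //= g gs ->; rewrite size_adj_bits eqxx. Qed.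

Lemma size_encode : size (encode G k l) = 4 + n * n * T.
Proof.
have := all_size_adj_bits G; rewrite -(all_map size (pred1 _)) => /all_pred1P G_shape.
by rewrite /encode size_cat /= size_flatten /shape G_shape sumn_nseq !size_map size_tuple.
Qed.

Lemma nth_adj_bits (g : sgraph V) (u v : V) :
  nth 0 (adj_bits g) (n * enum_rank u + enum_rank v) = adj g u v.
Proof.
rewrite /adj_bits mulnC (@nth_flatten_const _ _ _ n).
- by rewrite (nth_map u) -?cardE // (nth_map v) -?cardE // !nth_enum_rank.
- by rewrite all_map; apply/allP => w _ /=; rewrite size_map -cardE.
- exact: ltn_ord.
- by rewrite size_map -cardE; apply: ltn_ord.
Qed.

Lemma nbr_closed_nbh (i : 'I_T) (u v : V) :
  nbr i (enum_rank u) (enum_rank v) = (v \in closed_nbh (tnth G i) u).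
Proof.
rewrite inE /nbr /input_nbr (inj_eq val_inj) (inj_eq enum_rank_inj); congr (_ || _).
rewrite -!addnA [encode G k l]/(_ ++ _) [nth _ _ _]/= (@nth_flatten_const _ _ _ (n * n)).
- by rewrite (nth_map (tnth G i)) ?size_tuple // -tnth_nth nth_adj_bits; case: adj.
- exact: all_size_adj_bits.
- by have := ltn_ord (enum_rank u); have := ltn_ord (enum_rank v); rewrite -/n; nia.
- by rewrite size_map size_tuple.
Qed.

Definition interval_code (x : triple V T) : nat * nat :=
  (nat_of_ord (enum_rank (vtx x)), nat_of_ord (start x)).

Definition timeline_code (S : {set triple V T}) : schedule :=
  [seq interval_code x | x <- enum S].

Lemma count_timeline_code S v :
  count_mem (nat_of_ord (enum_rank v)) (unzip1 (timeline_code S)) =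
  #|[set x in S | vtx x == v]|.
Proof.
rewrite /unzip1 -map_comp count_map -size_filter [RHS]cardE; apply/perm_size/uniq_perm.
- exact/filter_uniq/enum_uniq.
- exact: enum_uniq.
move=> x; rewrite mem_filter !mem_enum [RHS]inE andbC /=; congr (_ && _).
by rewrite (inj_eq val_inj) (inj_eq enum_rank_inj).
Qed.

Lemma timeline_code_feasible S : is_timeline k l S -> feasible n k (timeline_code S).
Proof.
move=> /and3P[_ /forallP S_count _]; split=> [|v].
  by rewrite !all_map; apply/allP => x _ /=.
have [vn|nv] := ltnP v n.
  have := S_count (enum_val (Ordinal vn)).
  by rewrite -count_timeline_code enum_valK.
rewrite (_ : count_mem _ _ = 0) //; apply/count_memPn/mapP => -[_ /mapP[x _ ->] v_x].
by have := ltn_ord (enum_rank (vtx x)); move: v_x => /= <-; rewrite -/n ltnNge nv.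
Qed.

Lemma timeline_code_covers S (v : V) (i : 'I_T) : is_timeline k l S -> dominates G S v i ->
  covers l nbr (timeline_code S) i (enum_rank v).
Proof.
move=> /and3P[_ _ /forall_inP S_len] /existsP[u /andP[/existsP[x /and3P[xS /eqP <-]]]].
move=> /andP[ai ib] uv; apply/hasP; exists (interval_code x); first by rewrite map_f ?mem_enum.
rewrite nbr_closed_nbh uv /= ai andbT.
by have := S_len x xS; rewrite /interval_length; move: ai ib => /=; lia.
Qed.

Definition timeline_of (s : schedule) : {set triple V T} :=
  [set x | (interval_code x \in s) && (nat_of_ord (stop x) == minn (start x + l) T.-1)].

Lemma interval_code_inj s : {in timeline_of s &, injective interval_code}.
Proof.
move=> [[u a] b] [[u' a'] b']; rewrite !inE /interval_code /vtx /start /stop /=.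
move=> /andP[_ /eqP b_a] /andP[_ /eqP b'_a'] [/val_inj/enum_rank_inj u_u' /val_inj a_a'].
by rewrite u_u' a_a' in b_a *; congr (_, _); apply/val_inj; rewrite /= b_a b'_a'.
Qed.

Lemma timeline_of_timeline s : feasible n k s -> is_timeline k l (timeline_of s).
Proof.
move=> [s_n s_count]; apply/and3P; split.
- apply/forall_inP => x; rewrite inE /is_interval => /andP[_ /eqP ->].
  by have := ltn_ord (start x); lia.
- apply/forallP => v; apply: leq_trans (s_count (enum_rank v)).
  rewrite count_map -size_filter [X in X <= _]cardE -(size_map interval_code).
  apply: uniq_leq_size.
    rewrite map_inj_in_uniq ?enum_uniq // => x y; rewrite !mem_enum !inE.
    by move=> /andP[xs _] /andP[ys _]; apply: (interval_code_inj (s := s)); rewrite inE.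
  move=> y /mapP[x]; rewrite mem_enum !inE => /andP[/andP[xs _] /eqP xv] ->.
  by rewrite mem_filter xs /= xv eqxx.
- by apply/forall_inP => x; rewrite inE /interval_length => /andP[_ /eqP ->]; lia.
Qed.

Lemma timeline_of_dominates s (v : V) (i : 'I_T) : feasible n k s ->
  covers l nbr s i (enum_rank v) -> dominates G (timeline_of s) v i.
Proof.
move=> [s_n _] /hasP[[u a] us /= /andP[/andP[ai il] uv]].
have un : u < n by apply: (allP s_n); apply/mapP; exists (u, a).
have aT : a < T by apply: leq_ltn_trans ai _.
have bT : minn (a + l) T.-1 < T by lia.
apply/existsP; exists (enum_val (Ordinal un)); rewrite -nbr_closed_nbh enum_valK uv andbT.
apply/existsP; exists (enum_val (Ordinal un), Ordinal aT, Ordinal bT).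
rewrite inE /interval_code /vtx /start /stop /= enum_valK /= us !eqxx ai /=.
by have := ltn_ord i; lia.
Qed.

Lemma tds_solvable : timeline_dominating_set G k l <-> solvable n T k l nbr.
Proof.
split=> [/existsP[S /andP[S_ok /forallP S_dom]]|[s s_ok s_dom]].
  exists (timeline_code S); first exact: timeline_code_feasible.
  move=> i iT; apply/allP => v; rewrite mem_iota => vn.
  have /forallP/(_ (Ordinal iT)) := S_dom (enum_val (Ordinal (vn : v < n))).
  by move/(timeline_code_covers S_ok); rewrite enum_valK.
apply/existsP; exists (timeline_of s); rewrite timeline_of_timeline //.
apply/forallP => v; apply/forallP => i; apply: timeline_of_dominates => //.
by apply: (allP (s_dom i (ltn_ord i))); rewrite mem_iota ltn_ord.
Qed.

Lemma tds_card0 : n = 0 -> timeline_dominating_set G k l.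
Proof.
move=> /fintype0 V0; apply/existsP; exists set0; apply/andP; split.
  by apply/and3P; split; [apply/forall_inP => x|apply/forallP => v|apply/forall_inP => x];
     rewrite ?inE //; case: (V0 v).
by apply/forallP => v; case: (V0 v).
Qed.

Lemma tds_leq : T <= k -> timeline_dominating_set G k l.
Proof.
move=> Tk; apply/existsP; exists [set x | start x == stop x]; apply/andP; split.
  apply/and3P; split.
  - by apply/forall_inP => x; rewrite inE /is_interval => /eqP ->.
  - apply/forallP => v; apply: leq_trans Tk; rewrite -[X in _ <= X]card_ord.
    rewrite -(card_in_imset (f := @start V T)) ?max_card // => -[[u a] b] [[u' a'] b'].
    rewrite !inE /vtx /start /stop /=.
    by move=> /andP[/eqP -> /eqP ->] /andP[/eqP -> /eqP ->] ->.
  - by apply/forall_inP => x; rewrite inE /interval_length => /eqP ->; rewrite subnn.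
apply/forallP => v; apply/forallP => i; apply/existsP; exists v.
rewrite inE eqxx andbT; apply/existsP; exists (v, i, i).
by rewrite inE /vtx /start /stop /= !eqxx leqnn.
Qed.

End Encoding.

(** * The program *)

(* [rUntil], [rLeft], [rMark] and [rWord] hold the base addresses of the arrays
   that store, per vertex, the first time at which it is inactive again, the
   number of intervals it may still start and whether it is marked as dominated
   at time [rI], and the [rLen] letters of the current word. [rSnap] is the
   address of the adjacency matrix of snapshot [rI], [rRow] that of the row of
   vertex [rV], [rPos] the position of the next letter and [rUnd] the number of
   undominated vertices; [rHI], [rHV] and [rHY] count down the loops indexed by
   [rI], [rV] and [rY]. *)
Local Notation rRes := 0 (only parsing).
Local Notation rN := 3 (only parsing).
Local Notation rT := 4 (only parsing).
Local Notation rK := 5 (only parsing).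
Local Notation rL := 6 (only parsing).
Local Notation rNN := 7 (only parsing).
Local Notation rUntil := 8 (only parsing).
Local Notation rLeft := 9 (only parsing).
Local Notation rMark := 10 (only parsing).
Local Notation rWord := 11 (only parsing).
Local Notation rLen := 12 (only parsing).
Local Notation rI := 13 (only parsing).
Local Notation rHI := 14 (only parsing).
Local Notation rV := 15 (only parsing).
Local Notation rHV := 16 (only parsing).
Local Notation rY := 17 (only parsing).
Local Notation rHY := 18 (only parsing).
Local Notation rSnap := 19 (only parsing).
Local Notation rRow := 20 (only parsing).
Local Notation rPos := 21 (only parsing).
Local Notation rUnd := 22 (only parsing).
Local Notation rGo := 23 (only parsing).
Local Notation rOk := 24 (only parsing).
Local Notation rMore := 25 (only parsing).
Local Notation rCarry := 26 (only parsing).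
Local Notation rA := 27 (only parsing).
Local Notation rB := 28 (only parsing).
Local Notation rC := 29 (only parsing).

Local Notation Sub := Defs.Sub.
Local Notation skip := (Blk [::]).

Definition add_mul (d s c : nat) : cmd := for_loop rY rHY c (Blk [:: Add d d s]).

Definition mark_row : cmd :=
  for_loop rY rHY rN
    (Blk [:: Add rA rRow rY; Get rB rA; Add rA rMark rY; Get rC rA; Add rC rC rB; Put rA rC]).

Definition mark : cmd :=
  Blk [:: Add rRow rSnap rZero] ;; add_mul rRow rN rV ;;
  Blk [:: Add rA rMark rV; Put rA rOne] ;; mark_row.

Definition unmark_all : cmd :=
  for_loop rY rHY rN (Blk [:: Add rA rMark rY; Put rA rZero]).

Definition mark_active : cmd :=
  for_loop rV rHV rN
    (Blk [:: Add rA rUntil rV; Get rB rA; Sub rB rB rI] ;; Ite rB mark skip).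

Definition count_unmarked : cmd :=
  Blk [:: Const rUnd 0] ;;
  for_loop rY rHY rN
    (Blk [:: Add rA rMark rY; Get rB rA; Sub rB rOne rB; Add rUnd rUnd rB]).

Definition test_pull : cmd :=
  count_unmarked ;; Ite rUnd (Blk [:: Sub rGo rLen rPos]) (Blk [:: Const rGo 0]).

Definition pull_step : cmd :=
  Blk [:: Add rA rWord rPos; Get rV rA; Add rPos rPos rOne; Add rA rLeft rV; Get rB rA] ;;
  Ite rB
    (Blk [:: Sub rB rB rOne; Put rA rB; Add rA rUntil rV; Add rB rI rL; Add rB rB rOne;
             Put rA rB] ;;
     mark)
    skip ;;
  test_pull.

Definition simulate_step : cmd :=
  (unmark_all ;; mark_active) ;; test_pull ;; While rGo pull_step ;;
  Ite rUnd (Blk [:: Const rOk 0]) skip ;; Blk [:: Add rSnap rSnap rNN].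

Definition reset : cmd :=
  for_loop rY rHY rN (Blk [:: Add rA rUntil rY; Put rA rZero; Add rA rLeft rY; Put rA rK]).

Definition simulate : cmd :=
  reset ;; Blk [:: Const rPos 0; Const rSnap 4; Const rOk 1] ;; for_loop rI rHI rT simulate_step.

Definition advance_step : cmd :=
  Blk [:: Add rA rWord rY; Get rB rA; Add rB rB rCarry; Sub rC rN rB; Sub rCarry rOne rC] ;;
  Ite rCarry (Blk [:: Put rA rZero]) (Blk [:: Put rA rB]).

Definition advance : cmd :=
  Blk [:: Const rCarry 1] ;; for_loop rY rHY rLen advance_step ;; Blk [:: Sub rMore rOne rCarry].

Definition search_step : cmd :=
  simulate ;; Ite rOk (Blk [:: Const rRes 1]) skip ;; advance.

Definition setup : cmd :=
  add_mul rNN rN rN ;; Blk [:: Const rUntil 4] ;; add_mul rUntil rNN rT ;;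
  Blk [:: Add rLeft rUntil rN; Add rMark rLeft rN; Add rWord rMark rN] ;;
  add_mul rLen rK rN ;; Blk [:: Const rRes 0; Const rMore 1].

Definition decide_tds : cmd :=
  Blk [:: Const rOne 1; Get rN rZero; Get rT rOne; Add rA rOne rOne; Get rK rA;
          Add rA rA rOne; Get rL rA; Const rRes 1; Sub rB rT rK] ;;
  Ite rN (Ite rB (setup ;; While rMore search_step) skip) skip.

(** * Correctness and running time of the program *)

Local Ltac block := first [apply: runs_blk_seq | apply: runs_blk]; rewrite /= ?updE /=; first lia.

Lemma runs_add_mul d s c R M : R rZero = 0 -> R rOne = 1 ->
  d \notin [:: rZero; rOne; rY; rHY; s; c] -> s \notin [:: rY; rHY] ->
  c \notin [:: rZero; rOne; rY; rHY] ->
  runs (add_mul d s c) R M (R c * 5 + 4) (fun R' M' => R' d = R d + R s * R c /\ M' = M).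
Proof.
rewrite !inE !negb_or => R_zero R_one /and5P[d0 d1 dY dH /andP[ds dc]] /andP[sY sH].
move=> /and4P[c0 c1 cY cH].
apply: (@runs_for_const rY rHY c _ (fun j R' M' => R' d = R d + R s * j /\ M' = M) 1) => //.
- by rewrite /valid_loop /= !inE; lia.
- by move=> j R2 R3 M2 frame [<- ->]; rewrite frame // !inE negb_or dY dH.
- move=> j R2 M2 _ RY frame [Rd ->]; block.
  have Rs : R2 s = R s by apply: frame; rewrite /= !inE !negb_or sY sH eq_sym.
  by rewrite eqxx Rs Rd mulnSr addnA.
- by rewrite muln0 addn0.
Qed.

Section Correctness.
Variables (n T k l : nat) (x : seq nat).
Let until_base := 4 + n * n * T.
Let left_base := until_base + n.
Let mark_base := left_base + n.
Let word_base := mark_base + n.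
Let nbr := input_nbr x n.

Definition constants (R : store) : Prop :=
  [seq R r | r <- iota rZero rLen] =
  [:: 0; 1; n; T; k; l; n * n; until_base; left_base; mark_base; word_base; n * k].

Lemma constants_agree s R R' :
  agree_off s R R' -> ~~ has (mem s) (iota rZero rLen) -> constants R -> constants R'.
Proof.
by move=> frame /hasPn rs; rewrite /constants => <-; apply/eq_in_map => r /rs; apply: frame.
Qed.

Record layout (M us ls : nat -> nat) (d : pred nat) (ws : nat -> nat) : Prop := Layout {
  input_cell : forall a, a < until_base -> M a = nth 0 x a;
  until_cell : forall v, v < n -> M (until_base + v) = us v;
  left_cell : forall v, v < n -> M (left_base + v) = ls v;
  mark_cell : forall v, v < n -> (M (mark_base + v) != 0) = d v;
  word_cell : forall j, j < n * k -> M (word_base + j) = ws j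
}.

Lemma layout_ext M us ls d ws us' ls' d' ws' : layout M us ls d ws ->
  (forall v, v < n -> [/\ us v = us' v, ls v = ls' v & d v = d' v]) ->
  (forall j, j < n * k -> ws j = ws' j) ->
  layout M us' ls' d' ws'.
Proof.
move=> [M_input M_until M_left M_mark M_word] arrays_eq ws_eq.
split=> // [v vn|v vn|v vn|j jL]; rewrite ?M_until ?M_left ?M_mark ?M_word ?ws_eq //;
  by case: (arrays_eq v vn).
Qed.

Lemma layout_put_until M us ls d ws v y : v < n -> layout M us ls d ws ->
  layout (upd M (until_base + v) y) (upd us v y) ls d ws.
Proof.
move=> vn [M_input M_until M_left M_mark M_word]; split=> z zn;
  rewrite !updE ?eqn_add2l ?M_until //; by rewrite ifF; [auto|lia].
Qed.

Lemma layout_put_left M us ls d ws v y : v < n -> layout M us ls d ws ->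
  layout (upd M (left_base + v) y) us (upd ls v y) d ws.
Proof.
move=> vn [M_input M_until M_left M_mark M_word]; split=> z zn;
  rewrite !updE ?eqn_add2l ?M_left //; by rewrite ifF; [auto|lia].
Qed.

Lemma layout_put_mark M us ls d ws v y : v < n -> layout M us ls d ws ->
  layout (upd M (mark_base + v) y) us ls (fun z => if z == v then y != 0 else d z) ws.
Proof.
move=> vn [M_input M_until M_left M_mark M_word]; split=> z zn; rewrite updE ?eqn_add2l;
  try (rewrite ifF; [by auto|lia]).
by case: (z == v); rewrite ?M_mark.
Qed.

Lemma layout_put_letter M us ls d ws j y : j < n * k -> layout M us ls d ws ->
  layout (upd M (word_base + j) y) us ls d (upd ws j y).
Proof.
move=> jn [M_input M_until M_left M_mark M_word]; split=> i i_lt;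
  rewrite !updE ?eqn_add2l ?M_word //; by rewrite ifF; [auto|lia].
Qed.

Lemma snapshot_lt i u y : i < T -> u < n -> y < n -> 4 + i * (n * n) + n * u + y < until_base.
Proof.
move=> iT un yn; rewrite /until_base -!addnA ltn_add2l.
have iT_nn : i.+1 * (n * n) <= n * n * T by rewrite mulnC leq_mul2l iT orbT.
have un_nn : u.+1 * n <= n * n by rewrite leq_mul2r un orbT.
lia.
Qed.

Lemma runs_mark_row i u us ls d ws R M :
  i < T -> u < n -> constants R -> R rRow = 4 + i * (n * n) + n * u -> layout M us ls d ws ->
  runs mark_row R M (10 * n + 4) (fun _ M' =>
    layout M' us ls (fun z => d z || (nth 0 x (4 + i * (n * n) + n * u + z) != 0)) ws).
Proof.
move=> iT un R_const R_row M_layout; have [R_zero R_one R_n _ _ _ _ _ _ _ _ _] := R_const.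
pose bit z := nth 0 x (4 + i * (n * n) + n * u + z) != 0.
apply: runs_conseq (runs_for_const (t := 6)
  (I := fun j _ M' => layout M' us ls (fun z => d z || (z < j) && bit z) ws)
  _ _ R_zero R_one _ _) _ _ => //.
- move=> y R2 M2; rewrite R_n => yn RY frame M2_layout; block.
  have -> : R2 rMark = mark_base by rewrite frame //; case: R_const.
  rewrite RY frame // R_row [M2 (4 + _ + _ + _)](input_cell M2_layout) ?snapshot_lt //.
  apply: layout_ext (layout_put_mark _ yn M2_layout) _ _ => // z zn; split=> //.
  have [->|zy] := eqVneq z y; last by rewrite ltnS (leq_eqVlt z) (negbTE zy).
  by rewrite addn_eq0 negb_and (mark_cell M2_layout) // ltnn ltnSn orbF.
- by apply: layout_ext M_layout _ _ => // z _; rewrite orbF.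
- by rewrite R_n; lia.
- move=> _ M' _ M'_layout; rewrite R_n in M'_layout.
  by apply: layout_ext M'_layout _ _ => // z zn; rewrite zn.
Qed.

Lemma runs_mark i u us ls d ws R M :
  i < T -> u < n -> constants R -> R rSnap = 4 + i * (n * n) -> R rV = u -> layout M us ls d ws ->
  runs mark R M (21 * n) (fun _ M' => layout M' us ls (fun z => d z || nbr i u z) ws).
Proof.
move=> iT un R_const R_snap RV M_layout; have [R_zero R_one R_n _ _ _ _ _ _ _ _ _] := R_const.
block; rewrite R_zero addn0; set R2 := upd _ _ _.
have R2_const : constants R2 := R_const; have R2V : R2 rV = u := RV.
apply: runs_seq (runs_add_mul _ R_zero R_one _ _ _) _ _ => //; first by rewrite R2V; lia.
move=> R3 M3 frame3 [R3_row ->].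
have R3_const : constants R3 by apply: constants_agree frame3 _ R2_const.
have [_ R3_one _ _ _ _ _ _ _ R3_mark _ _] := R3_const.
block; rewrite R3_mark R3_one frame3 // R2V.
apply: runs_conseq (runs_mark_row iT un _ _ (layout_put_mark 1 un M_layout)) _ _ => //=.
- by rewrite updE /= R3_row R2V [R2 rN]R_n [R2 rRow]R_snap mulnC.
- lia.
move=> _ M' _ M'_layout; apply: layout_ext M'_layout _ _ => // z zn; split=> //.
by rewrite /nbr /input_nbr; case: eqP; rewrite ?orbT.
Qed.

Lemma runs_unmark_all us ls d ws R M : constants R -> layout M us ls d ws ->
  runs unmark_all R M (6 * n + 4) (fun _ M' => layout M' us ls pred0 ws).
Proof.
move=> R_const M_layout; have [R_zero R_one R_n _ _ _ _ _ _ _ _ _] := R_const.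
apply: runs_conseq
  (runs_for_const (t := 2) (I := fun j _ M' => layout M' us ls (fun z => (j <= z) && d z) ws)
     _ _ R_zero R_one _ M_layout) _ _ => //.
- move=> y R2 M2; rewrite R_n => yn RY frame M2_layout; block.
  have -> : R2 rMark = mark_base by rewrite frame //; case: R_const.
  rewrite RY frame // R_zero.
  apply: layout_ext (layout_put_mark 0 yn M2_layout) _ _ => // z zn; split=> //.
  by rewrite [y < z]ltn_neqAle eq_sym; case: eqP.
- by rewrite R_n; lia.
- move=> _ M' _ M'_layout; rewrite R_n in M'_layout.
  by apply: layout_ext M'_layout _ _ => // z zn; rewrite leqNgt zn.
Qed.

Lemma runs_mark_active i us ls ws R M : i < T -> constants R -> R rI = i ->
  R rSnap = 4 + i * (n * n) -> layout M us ls pred0 ws ->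
  runs mark_active R M (21 * (n * n) + 9 * n + 4) (fun _ M' =>
    layout M' us ls (fun z => has (fun u => (i < us u) && nbr i u z) (iota 0 n)) ws).
Proof.
move=> iT R_const RI R_snap M_layout; have [R_zero R_one R_n _ _ _ _ _ _ _ _ _] := R_const.
pose marked j z := has (fun u => (i < us u) && nbr i u z) (iota 0 j).
have markedS j z : marked j.+1 z = marked j z || ((i < us j) && nbr i j z).
  by rewrite /marked iota0S has_rcons orbC.
apply: runs_conseq
  (runs_for_const (t := 21 * n + 5) (I := fun j _ M' => layout M' us ls (marked j) ws)
     _ _ R_zero R_one _ M_layout) _ _ => //.
- move=> v R2 M2; rewrite R_n => vn RV frame M2_layout.
  have R2_const : constants R2 by apply: constants_agree frame _ R_const.
  have [_ _ _ _ _ _ _ R2_until _ _ _ _] := R2_const.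
  block; rewrite R2_until RV (until_cell M2_layout) // [R2 rI]frame // RI.
  apply: runs_ite => /=; first lia; rewrite !updE /= => active.
    apply: runs_conseq (runs_mark iT vn _ _ _ M2_layout) _ _ => //=; last 2 first.
    + lia.
    + move=> _ M' _ M'_layout; apply: layout_ext M'_layout _ _ => // z zn; split=> //.
      by rewrite markedS -subn_gt0 lt0n (introN eqP active).
    + by rewrite !updE /= frame.
  block; apply: layout_ext M2_layout _ _ => // z zn; split=> //.
  by rewrite markedS -subn_gt0 active orbF.
- by rewrite R_n; lia.
- by move=> _ M' _; rewrite R_n.
Qed.

Lemma runs_count_unmarked us ls d ws R M : constants R -> layout M us ls d ws ->
  runs count_unmarked R M (8 * n + 5) (fun R' M' =>
    R' rUnd = count (predC d) (iota 0 n) /\ M' = M).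
Proof.
move=> R_const M_layout; have [R_zero R_one R_n _ _ _ _ _ _ _ _ _] := R_const.
have countS j : count (predC d) (iota 0 j.+1) = count (predC d) (iota 0 j) + ~~ d j.
  by rewrite iota0S -cats1 count_cat /= addn0.
block; apply: runs_conseq (runs_for_const (t := 4) (I := fun j R' M' =>
  R' rUnd = count (predC d) (iota 0 j) /\ M' = M) _ _ R_zero R_one _ _) _ _ => //=.
- by move=> j R2 R3 M2 frame [<- ->]; rewrite frame.
- move=> y R2 M2; rewrite !updE /= R_n => yn RY frame [R_und ->]; block.
  have -> : R2 rMark = mark_base by rewrite frame //; case: R_const.
  have -> : R2 rOne = 1 by rewrite frame.
  split=> //; apply: etrans (esym (countS y)).
  by rewrite -(mark_cell M_layout) // RY R_und; case: (M _).
- by rewrite !updE /= R_n; lia.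
- by move=> R' M' _; rewrite !updE /= R_n.
Qed.

Definition at_word (ws : nat -> nat) (w : seq nat) (R : store) : Prop :=
  R rPos <= n * k /\ w = drop (R rPos) (mkseq ws (n * k)).

Record simulates (i : nat) (ws : nat -> nat) (w : seq nat) (s : schedule)
    (d : pred nat) (R M : store) : Prop := Simulates {
  sim_constants : constants R;
  sim_snapshot : R rSnap = 4 + i * (n * n);
  sim_word : at_word ws w R;
  sim_layout : layout M (until l s) (left k s) d ws
}.

Lemma simulates_agree r i ws w s d R R' M :
  agree_off r R R' -> ~~ has (mem r) [:: rSnap, rPos & iota rZero rLen] ->
  simulates i ws w s d R M -> simulates i ws w s d R' M.
Proof.
move=> frame; rewrite /= negb_or => /andP[snap_r]; rewrite negb_or => /andP[pos_r ctx_r].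
move=> [R_const R_snap Rw M_layout]; split=> //; first exact: constants_agree frame ctx_r R_const.
  by rewrite frame.
by rewrite /at_word frame.
Qed.

Definition tested (i : nat) (ws : nat -> nat) (w : seq nat) (s : schedule)
    (R M : store) : Prop :=
  [/\ simulates i ws w s (covers l nbr s i) R M,
      (R rUnd == 0) = dominated n l nbr i s
    & R rGo = if dominated n l nbr i s then 0 else size w].

Lemma runs_test_pull i ws w s R M : simulates i ws w s (covers l nbr s i) R M ->
  runs test_pull R M (8 * n + 8) (tested i ws w s).
Proof.
move=> sim; have [R_const _ [pos_le w_pos] M_layout] := sim.
apply: runs_seq (runs_count_unmarked R_const M_layout) _ _; first lia.
move=> R2 M2 frame2 [R_und ->].
have sim2 : simulates i ws w s (covers l nbr s i) R2 M by apply: simulates_agree frame2 _ sim.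
have keep v : simulates i ws w s (covers l nbr s i) (upd R2 rGo v) M.
  by apply: simulates_agree (agree_off_upd v R2 (mem_head rGo [::])) _ sim2.
have undE : (R2 rUnd == 0) = dominated n l nbr i s.
  by rewrite R_und -leqn0 leqNgt -has_count has_predC negbK.
have [_ _ _ _ _ _ _ _ _ _ _ R_len] := sim_constants sim2.
apply: runs_ite => [|und|und]; first lia; block; split=> //; rewrite !updE /= -undE.
  by rewrite (introF eqP und) w_pos size_drop size_mkseq R_len frame2.
by rewrite und.
Qed.

Lemma at_word_cons ws v w R : at_word ws (v :: w) R ->
  [/\ R rPos < n * k, ws (R rPos) = v & w = drop (R rPos).+1 (mkseq ws (n * k))].
Proof.
move=> [_ w_pos]; have pos_lt : R rPos < n * k.
  by rewrite -subn_gt0 -[n * k](size_mkseq ws) -size_drop -w_pos.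
by move: w_pos; rewrite (drop_nth 0) ?size_mkseq // nth_mkseq // => -[-> ->].
Qed.

Lemma runs_pull_step i ws v w s R M :
  i < T -> v < n -> starts_by i s -> R rI = i -> simulates i ws (v :: w) s (covers l nbr s i) R M ->
  runs pull_step R M (29 * n + 21) (tested i ws w (pull_letter k i v s)).
Proof.
move=> iT vn s_i RI [R_const R_snap Rw M_layout].
have [pos_lt ws_pos w_pos] := at_word_cons Rw.
have [R_zero R_one R_n _ _ R_l _ R_until R_left _ R_word _] := R_const.
block; rewrite R_word (word_cell M_layout) // ws_pos R_left (left_cell M_layout) // R_one addn1.
set R2 := upd _ _ _.
have simI R' s' d M' : constants R' -> R' rSnap = R rSnap -> R' rPos = (R rPos).+1 ->
    layout M' (until l s') (left k s') d ws -> simulates i ws w s' d R' M'.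
  by move=> R_const' R'_snap R'_pos; split; rewrite ?R'_snap // /at_word R'_pos.
apply: (@runs_seq _ _ _ _ (21 * n + 8) _ (fun R' M' =>
  simulates i ws w (pull_letter k i v s) (covers l nbr (pull_letter k i v s) i) R' M')); first last.
- move=> R3 M3 _ sim3; apply: runs_conseq (runs_test_pull sim3) _ _ => //; lia.
- lia.
have R2B : R2 rB = left k s v by [].
apply: runs_ite; rewrite ?R2B; [lia|move=> left_pos|move=> left_0]; last first.
  by block; rewrite /pull_letter left_0; apply: simI.
have {}left_pos : 0 < left k s v by rewrite lt0n; apply/eqP.
rewrite /pull_letter left_pos; block.
rewrite [R2 rUntil]R_until [R2 rI]RI [R2 rL]R_l [R2 rOne]R_one addn1 subn1.
set M2 := upd _ (until_base + v) _; set R3 := upd _ _ _.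
have M2_layout : layout M2 (until l ((v, i) :: s)) (left k ((v, i) :: s)) (covers l nbr s i) ws.
  apply: layout_ext (layout_put_until _ vn (layout_put_left _ vn M_layout)) _ _ => // u _.
  by rewrite until_cons // left_cons.
apply: runs_conseq (runs_mark iT vn _ _ _ M2_layout) _ _ => //; first lia.
move=> R4 M4 frame4 M4_layout; apply: (simulates_agree frame4) => //; apply: simI => //.
apply: layout_ext M4_layout _ _ => // z _; split=> //.
by rewrite /covers /= leqnn leq_addr orbC.
Qed.

Lemma runs_pull_loop i ws w s R M :
  i < T -> all (gtn n) w -> starts_by i s -> R rI = i -> tested i ws w s R M ->
  let st := pull n k l nbr i w s in
  runs (While rGo pull_step) R M ((29 * n + 23) * (size w - size st.1) + 2)
    (tested i ws st.1 st.2).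
Proof.
move=> iT; elim: w s R M => [|v w IH] s R M /= wn s_i RI tst; have [sim undE goE] := tst.
  by apply: runs_while; [lia|rewrite goE if_same|].
have /andP[vn wn'] := wn; case: ifP goE => s_dom goE /=.
  by apply: runs_while; [lia|rewrite goE|].
apply: runs_while; [exact: leq_addl|move=> _|by rewrite goE].
apply: runs_seq (runs_pull_step iT vn s_i RI sim) _ _ => [|R2 M2 frame2 tst2].
  by rewrite subSn ?pull_size // mulnS addnK (leq_trans _ (leq_addr _ _)) // leq_add2l.
apply: runs_conseq (IH _ _ _ wn' (pull_letter_starts_by k v s_i) _ tst2) _ _ => //.
  by rewrite frame2.
by rewrite subSn ?pull_size // mulnS; lia.
Qed.

Lemma runs_mark_dominated i ws w s d R M :
  i < T -> feasible n k s -> starts_by i s -> R rI = i -> simulates i ws w s d R M ->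
  runs (unmark_all ;; mark_active) R M (21 * (n * n) + 15 * n + 8)
    (simulates i ws w s (covers l nbr s i)).
Proof.
move=> iT [s_n _] s_i RI sim; have [R_const R_snap _ M_layout] := sim.
apply: runs_seq (runs_unmark_all R_const M_layout) _ _ => [|R2 M2 frame2 M2_layout]; first lia.
have R2_const : constants R2 by apply: constants_agree frame2 _ R_const.
apply: runs_conseq (runs_mark_active iT R2_const _ _ M2_layout) _ _; rewrite ?frame2 //; first lia.
move=> R3 M3 frame3 M3_layout.
have [R3_const R3_snap R3_word _] : simulates i ws w s d R3 M.
  by apply: simulates_agree frame3 _ (simulates_agree frame2 _ sim).
split=> //; apply: layout_ext M3_layout _ _ => // z _; split=> //.
exact/esym/covers_until.
Qed.

Lemma runs_simulate_step i ws w s d R M :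
  i < T -> 0 < n -> all (gtn n) w -> feasible n k s -> starts_by i s -> R rI = i ->
  simulates i ws w s d R M ->
  let st := pull n k l nbr i w s in
  runs simulate_step R M (67 * (n * n) + 52 * (n * (size w - size st.1))) (fun R' M' =>
    (exists d', simulates i.+1 ws st.1 st.2 d' R' M') /\
    R' rOk = if dominated n l nbr i st.2 then R rOk else 0).
Proof.
move=> iT n0 wn s_ok s_i RI sim st; set c := size w - size st.1.
have n_nn : n <= n * n by rewrite leq_pmulr.
have c_nc : c <= n * c by rewrite leq_pmull.
have c_cost : (29 * n + 23) * c <= 52 * (n * c) by rewrite mulnDl -!mulnA; lia.
apply: runs_seq (runs_mark_dominated iT s_ok s_i RI sim) _ _ => [|R2 M2 frame2 sim2]; first lia.
apply: runs_seq (runs_test_pull sim2) _ _ => [|R3 M3 frame3 tst3]; first lia.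
apply: runs_seq (runs_pull_loop iT wn s_i _ tst3) _ _ => [||R4 M4 frame4].
- by rewrite frame3 // frame2.
- by rewrite -/st -/c; lia.
rewrite -/st => -[[R4_const R4_snap R4_word M4_layout] undE _].
have [_ _ _ _ _ _ R4_nn _ _ _ _ _] := R4_const.
have R4_ok : R4 rOk = R rOk by rewrite frame4 // frame3 // frame2.
apply: (@runs_seq _ _ _ _ 3 _ (fun R' M' =>
  M' = M4 /\ R' rOk = if dominated n l nbr i st.2 then R rOk else 0)).
- apply: runs_ite => [//|und|und]; block; split=> //; rewrite -undE.
    by rewrite (introF eqP und).
  by rewrite und.
- lia.
- move=> R5 M5 frame5 [-> R5_ok]; block; split=> //; exists (covers l nbr st.2 i).
  have R5_const : constants R5 by apply: constants_agree frame5 _ R4_const.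
  split=> //; last by rewrite /at_word !updE /= frame5.
  by rewrite !updE /= !frame5 // R4_snap R4_nn mulSnr addnA.
Qed.

Lemma runs_reset us ls d ws R M : constants R -> layout M us ls d ws ->
  runs reset R M (8 * n + 4) (fun _ M' => layout M' (until l [::]) (left k [::]) d ws).
Proof.
move=> R_const M_layout; have [R_zero R_one R_n _ _ _ _ _ _ _ _ _] := R_const.
apply: runs_conseq (runs_for_const (t := 4) (I := fun j _ M' =>
  layout M' (fun v => if v < j then 0 else us v) (fun v => if v < j then k else ls v) d ws)
  _ _ R_zero R_one _ M_layout) _ _ => //.
- move=> v R2 M2; rewrite R_n => vn RV frame M2_layout; block.
  have [-> _ _ _ -> _ _ -> -> _ _ _] : constants R2 by apply: constants_agree frame _ R_const.
  rewrite RV.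
  apply: layout_ext (layout_put_left _ vn (layout_put_until _ vn M2_layout)) _ _ => // z _.
  by rewrite /upd ltnS [z <= v]leq_eqVlt; case: eqP.
- by rewrite R_n; lia.
- move=> _ M' _ M'_layout; rewrite R_n in M'_layout; apply: layout_ext M'_layout _ _ => // v vn.
  by rewrite vn /until big_nil /left subn0.
Qed.

Definition holds_word (ws M : nat -> nat) : Prop := exists us ls d, layout M us ls d ws.

Lemma cells_bounds : 0 < n -> k < T ->
  [/\ n <= n * n * T, T <= n * n * T, n * k <= n * n * T & n * (n * k) <= n * n * T].
Proof.
move=> n0 kT; have nnk_le : n * (n * k) <= n * n * T by rewrite mulnA leq_mul2l ltnW ?orbT.
split=> //.
- by rewrite -mulnA leq_pmulr // muln_gt0 n0 (leq_trans _ kT).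
- by rewrite leq_pmull // muln_gt0 n0.
- by apply: leq_trans nnk_le; rewrite leq_pmull.
Qed.

Definition step_time (w : seq nat) (i : nat) : nat :=
  67 * (n * n) +
  52 * (n * (size (greedy n k l nbr w i).1 - size (greedy n k l nbr w i.+1).1)).

Lemma sum_step_time w : 0 < n -> k < T -> size w = n * k ->
  \sum_(0 <= i < T) (step_time w i + 4) + 8 * n + 12 <= 150 * (n * n * T).
Proof.
move=> n0 kT w_size; have [n_le T_le _ nnk_le] := cells_bounds n0 kT.
rewrite /step_time !big_split -!big_distrr !sum_nat_const_nat subn0 /=.
set letters := \sum_(0 <= i < T) _.
have letters_le : n * letters <= n * n * T.
  apply: leq_trans nnk_le; rewrite leq_mul2l -w_size -(sum_consumed n k l nbr w T).
  by rewrite leq_addr orbT.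
lia.
Qed.

Lemma runs_simulate ws R M :
  0 < n -> k < T -> constants R -> all (gtn n) (mkseq ws (n * k)) -> holds_word ws M ->
  runs simulate R M (150 * (n * n * T)) (fun R' M' =>
    R' rOk = succeeds n k l nbr (mkseq ws (n * k)) T /\ holds_word ws M').
Proof.
move=> n0 kT R_const wn [us [ls [d M_layout]]]; have := sum_step_time n0 kT (size_mkseq ws _).
set w := mkseq _ _ in wn *; move=> time_le.
apply: runs_seq (runs_reset R_const M_layout) _ _ => [|R2 M2 frame2 M2_layout]; first lia.
have R2_const : constants R2 by apply: constants_agree frame2 _ R_const.
have [R2_zero R2_one _ R2_T _ _ _ _ _ _ _ _] := R2_const.
block; set R3 := upd _ _ _.
apply: runs_conseq (runs_for (t := step_time w) (I := fun i R' M' =>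
  (exists d', simulates i ws (greedy n k l nbr w i).1 (greedy n k l nbr w i).2 d' R' M') /\
  R' rOk = succeeds n k l nbr w i) _ _ R2_zero R2_one _ _) _ _ => //.
- move=> j R4 R5 M4 frame [[d' sim] R4_ok]; split; last by rewrite frame.
  by exists d'; apply: simulates_agree frame _ sim.
- move=> i R4 M4; rewrite [R3 rT]R2_T => iT RI frame [[d' sim] R4_ok].
  have [w_n s_ok s_i] := greedy_feasible k l nbr i wn.
  have := runs_simulate_step iT n0 w_n s_ok s_i RI sim.
  rewrite -greedyS => step.
  apply: runs_conseq step _ _ => // R5 M5 _ [sim5 R5_ok]; split=> //.
  by rewrite R5_ok R4_ok succeedsS; case: succeeds; case: dominated.
- split=> //; exists d; split=> //; split=> //.
  by rewrite drop0.
- by rewrite [R3 rT]R2_T; lia.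
- rewrite [R3 rT]R2_T => R4 M4 _ [[d' [_ _ _ M4_layout]] R4_ok]; split=> //.
  by do 3 eexists; apply: M4_layout.
Qed.

Lemma runs_advance_step N j us ls d R M : 0 < n -> j < n * k -> constants R ->
  R rY = j -> R rCarry = (n ^ j %| N.+1) ->
  layout M us ls d (fun z => digit n (if z < j then N.+1 else N) z) ->
  runs advance_step R M 8 (fun R' M' =>
    layout M' us ls d (fun z => digit n (if z < j.+1 then N.+1 else N) z) /\
    R' rCarry = (n ^ j.+1 %| N.+1)).
Proof.
move=> n0 jL R_const RY R_carry M_layout.
have [R_zero R_one R_n _ _ _ _ _ _ _ R_word _] := R_const.
have carryE : 1 - (n - (digit n N j + (n ^ j %| N.+1))) = (n ^ j.+1 %| N.+1).
  by rewrite -digit_carry //; case: leqP => ?; lia.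
have put_digit y : y = digit n N.+1 j -> layout (upd M (word_base + j) y) us ls d
    (fun z => digit n (if z < j.+1 then N.+1 else N) z).
  move=> y_digit; apply: layout_ext (layout_put_letter y jL M_layout) _ _ => // z _.
  by rewrite /upd ltnS (leq_eqVlt z); case: eqVneq => [->|].
block; rewrite R_word R_n R_one RY (word_cell M_layout) // ltnn R_carry carryE.
apply: runs_ite => [//|carry|carry]; block; split=> //; apply: put_digit; rewrite digitS //.
  by move: carry; rewrite !updE R_zero /=; case: (n ^ j.+1 %| _).
by move: carry; rewrite !updE /=; case: (n ^ j.+1 %| _).
Qed.

Lemma runs_advance N R M : 0 < n -> N < n ^ (n * k) -> constants R -> holds_word (digit n N) M ->
  runs advance R M (12 * (n * k) + 6) (fun R' M' =>
    R' rMore = (N.+1 < n ^ (n * k)) /\ holds_word (digit n N.+1) M').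
Proof.
move=> n0 N_lt R_const [us [ls [d M_layout]]].
have [R_zero R_one _ _ _ _ _ _ _ _ _ R_len] := R_const.
block; apply: runs_seq (runs_for_const (t := 8) (I := fun j R' M' =>
  layout M' us ls d (fun z => digit n (if z < j then N.+1 else N) z) /\
  R' rCarry = (n ^ j %| N.+1)) _ _ R_zero R_one _ _) _ _ => //=.
- by move=> j R2 R3 M2 frame [M2_layout <-]; rewrite frame.
- move=> j R2 M2; rewrite [upd _ _ _ rLen]R_len => jL RY frame [M2_layout R_carry].
  by apply: runs_advance_step => //; apply: constants_agree frame _ R_const.
- by split; [exact: M_layout|rewrite dvd1n].
- by rewrite [upd _ _ _ rLen]R_len; lia.
- move=> R2 M2 frame; rewrite [upd _ _ _ rLen]R_len => -[M2_layout R_carry].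
  block; split.
    rewrite frame // [upd _ _ _ rOne]R_one R_carry /dvdn.
    have [N_last|] := eqVneq N.+1 (n ^ (n * k)); first by rewrite N_last modnn ltnn.
    by move=> N_next; rewrite ltn_neqAle N_next N_lt modn_small // ltn_neqAle N_next.
  by exists us, ls, d; apply: layout_ext M2_layout _ _ => // j jL; rewrite jL.
Qed.

Lemma runs_search_step N R M :
  0 < n -> k < T -> N < n ^ (n * k) -> constants R -> holds_word (digit n N) M ->
  R rRes = found n T k l nbr N ->
  runs search_step R M (190 * (n * n * T)) (fun R' M' =>
    [/\ R' rRes = found n T k l nbr N.+1, R' rMore = (N.+1 < n ^ (n * k))
      & holds_word (digit n N.+1) M']).
Proof.
move=> n0 kT N_lt R_const M_word R_res; have [n_le _ nk_le _] := cells_bounds n0 kT.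
apply: runs_seq (runs_simulate n0 kT R_const (all_word k N n0) M_word) _ _; first lia.
move=> R2 M2 frame2 [R2_ok M2_word].
apply: (@runs_seq _ _ _ _ 3 _ (fun R' M' =>
  [/\ constants R', R' rRes = found n T k l nbr N.+1 & M' = M2])); first last.
- move=> R3 M3 _ [R3_const R3_res ->].
  apply: runs_conseq (runs_advance n0 N_lt R3_const M2_word) _ _; first lia.
  by move=> R4 M4 frame4 [R4_more M4_word]; split=> //; rewrite frame4.
- lia.
have R2_const : constants R2 by apply: constants_agree frame2 _ R_const.
apply: runs_ite => [//||]; rewrite R2_ok => ok; block; split=> //; rewrite foundS.
  by case: succeeds ok; rewrite ?orbT.
by rewrite frame2 // R_res; case: succeeds ok; rewrite ?orbF.
Qed.

Lemma runs_search m N R M :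
  0 < n -> k < T -> N + m = n ^ (n * k) -> constants R -> holds_word (digit n N) M ->
  R rRes = found n T k l nbr N -> R rMore = (N < n ^ (n * k)) ->
  runs (While rMore search_step) R M (192 * (n * n * T) * m + 2) (fun R' _ =>
    R' rRes = found n T k l nbr (n ^ (n * k))).
Proof.
move=> n0 kT; have [n_le _ _ _] := cells_bounds n0 kT.
elim: m N R M => [|m IH] N R M Nm R_const M_word R_res R_more.
  apply: runs_while; [lia|by rewrite R_more -Nm addn0 ltnn|].
  by rewrite -Nm addn0.
have N_lt : N < n ^ (n * k) by lia.
rewrite mulnS; apply: runs_while; [lia|move=> _|by rewrite R_more N_lt].
apply: runs_seq (runs_search_step n0 kT N_lt R_const M_word R_res) _ _; first lia.
move=> R2 M2 frame2 [R2_res R2_more M2_word].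
have R2_const : constants R2 by apply: constants_agree frame2 _ R_const.
by apply: runs_conseq (IH N.+1 _ _ _ R2_const M2_word R2_res R2_more) _ _ => //; lia.
Qed.

Lemma runs_setup R M :
  [seq R r | r <- iota rZero rNN] = [:: 0; 1; n; T; k; l; 0] -> R rLen = 0 ->
  runs setup R M (10 * n + 5 * T + 18) (fun R' M' =>
    [/\ constants R', R' rRes = 0, R' rMore = 1 & M' = M]).
Proof.
move=> [R_zero R_one R_n R_T R_k R_l R_nn] R_len.
apply: runs_seq (runs_add_mul _ R_zero R_one _ _ _) _ _ => //; first by rewrite R_n; lia.
rewrite R_nn R_n add0n => R2 M2 frame2 [R2_nn ->].
have R2_params : [seq R2 r | r <- iota rZero rNN] = [:: 0; 1; n; T; k; l; n * n].
  by rewrite /= R2_nn !frame2 // R_zero R_one R_n R_T R_k R_l.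
have [R2_zero R2_one R2_n R2_T R2_k R2_l _] := R2_params.
block; set R3 := upd _ _ _; have R3_until : R3 rUntil = 4 by [].
have R3_T : R3 rT = T := R2_T; have R3_nn : R3 rNN = n * n := R2_nn.
apply: runs_seq (runs_add_mul _ R2_zero R2_one _ _ _) _ _ => //; first by rewrite R3_T; lia.
rewrite R3_T R3_nn => R4 M4 frame4 [R4_until ->].
have R4_params : [seq R4 r | r <- iota rZero rNN] = [:: 0; 1; n; T; k; l; n * n].
  by rewrite /= !frame4.
have [R4_zero R4_one R4_n R4_T R4_k R4_l R4_nn] := R4_params.
block; rewrite R4_until R3_until -/until_base R4_n; set R5 := upd _ _ _.
have R5_n : R5 rN = n := R4_n; have R5_k : R5 rK = k := R4_k.
apply: runs_seq (runs_add_mul _ R4_zero R4_one _ _ _) _ _ => //; first by rewrite R5_n; lia.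
rewrite R5_n R5_k => R6 M6 frame6 [R6_len ->].
have R5_len : R5 rLen = 0 by rewrite [R5 rLen]frame4 // [R3 rLen]frame2.
block; split=> //; rewrite /constants /= !updE /= R6_len R5_len !frame6 // /R5 !updE /=.
by rewrite R4_zero R4_one R4_n R4_T R4_k R4_l R4_nn R4_until R3_until -/until_base mulnC.
Qed.

End Correctness.

Lemma tds_found (V : finType) (T : nat) (G : temporal_graph V T) (k l : nat) : 0 < #|V| ->
  timeline_dominating_set G k l =
  found #|V| T k l (input_nbr (encode G k l) #|V|) (#|V| ^ (#|V| * k)).
Proof.
move=> n0; apply/idP/idP => [/tds_solvable/(solvable_found T k l _ n0)//|].
by move/(solvable_found T k l _ n0)/tds_solvable.
Qed.

Lemma layout_encode (V : finType) (T : nat) (G : temporal_graph V T) (k l : nat) :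
  layout #|V| T k (encode G k l) (nth 0 (encode G k l)) (fun=> 0) (fun=> 0) pred0 (digit #|V| 0).
Proof.
by split=> // j jn; rewrite /digit ?div0n ?mod0n nth_default // size_encode; lia.
Qed.

Lemma runs_decide_tds (V : finType) (T : nat) (G : temporal_graph V T) (k l : nat) :
  runs decide_tds (fun=> 0) (nth 0 (encode G k l)) (250 * maxn 1 (#|V| ^ (2 + #|V| * k) * T))
    (fun R _ => R rRes = timeline_dominating_set G k l).
Proof.
set x := encode G k l; set n := #|V|; set t := 250 * _.
have t_ge : 250 <= t by rewrite leq_pmulr // leq_max.
block; set R1 := upd _ _ _.
have R1_n : R1 rN = n by []; have R1_Tk : R1 rB = T - k by [].
apply: runs_ite; rewrite ?R1_n; [lia|move=> n_neq0|by move=> n0; block; rewrite tds_card0].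
apply: runs_ite; rewrite ?R1_Tk; [lia|move=> kT|by move=> kT; block; rewrite tds_leq //; lia].
have n0 : 0 < n by lia.
have {}kT : k < T by lia.
have [n_le T_le _ _] := cells_bounds n0 kT.
have words_ge : n * n * T <= n * n * T * n ^ (n * k) by rewrite leq_pmulr // expn_gt0 n0.
have {}t_ge : 250 * (n * n * T * n ^ (n * k)) <= t.
  by rewrite leq_mul2l leq_max expnD mulnn mulnAC leqnn orbT.
apply: runs_seq (@runs_setup n T k l R1 _ _ _) _ _ => //; first lia.
move=> R2 M2 _ [R2_const R2_res R2_more ->].
apply: runs_conseq
  (runs_search (m := n ^ (n * k)) (x := x) n0 kT (add0n _) R2_const _ R2_res _) _ _ => //.
- by exists (fun=> 0), (fun=> 0), pred0; apply: layout_encode.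
- by rewrite R2_more expn_gt0 n0.
- by rewrite -mulnA; lia.
- by move=> R3 M3 _ ->; rewrite -tds_found.
Qed.

Theorem theorem5p1 :
  exists (p : program) (C : nat),
    forall (V : finType) (T : nat) (G : temporal_graph V T) (k l : nat),
      1 <= k ->
      exists2 t : nat,
        t <= C * maxn 1 (#|V| ^ (2 + #|V| * k) * T)
        & computes_in p (encode G k l) t
            (nat_of_bool (timeline_dominating_set G k l)).
Proof.
exists (compile 0 decide_tds), 250 => V T G k l _.
have [t [R [M [steps t_le <-]]]] := runs_decide_tds G k l.
by exists t => //; apply: compile_computes steps _ _.
Qed.
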